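(* The Albertson--Berman conjecture, that every planar graph $G$ satisfies $a(G)\ge |V(G)|/2$, is false. In particular, it already fails for simple planar graphs of minimum degree five: there exists a simple planar graph $G$ with $\delta(G)=5$ and $a(G)<|V(G)|/2$.
   Context: For a finite graph $G$, $a(G)$ denotes the maximum number of vertices in an induced forest of $G$, i.e. the maximum of $|F|$ over $F\subseteq V(G)$ such that $G[F]$ is acyclic. $\delta(G)$ denotes the minimum degree of $G$. *)

(* Defs.v *)
From HB Require Import structures.
From mathcomp Require Import all_boot all_order all_algebra.
From mathcomp Require Import all_classical all_reals all_analysis.

Set Implicit Arguments.
Unset Strict Implicit.
Unset Printing Implicit Defensive.

Import Order.TTheory GRing.Theory Num.Theory.
Import numFieldNormedType.Exports.

Local Open Scope classical_set_scope.
Local Open Scope ring_scope.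

Record sgraph := SGraph {
  vertex :> finType;
  adj : rel vertex;
  adj_sym : symmetric adj;
  adj_irrefl : irreflexive adj }.

Definition edges (G : sgraph) : {set {set G}} :=
  [set [set x; y] | x in G, y in adj x]%SET.

Definition degree (G : sgraph) (x : G) : nat := #|[set y | adj x y]%SET|.

(* Degrees are smaller than #|G|, so that the default value of the iterated
   minimum is irrelevant as soon as G has a vertex. *)
Definition min_degree (G : sgraph) : nat :=
  \big[minn/#|G|]_(x : G) degree x.

Definition induced (G : sgraph) (F : {set G}) : sgraph :=
  @SGraph {x : G | x \in F} (fun x y => adj (val x) (val y))
    (fun x y => adj_sym (val x) (val y)) (fun x => adj_irrefl (val x)).

(* The bound on the size excludes the closed walk x, y, x along one edge. *)
Definition acyclic (G : sgraph) : Prop :=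
  forall c : seq G, (2 < size c)%N -> ~ ucycle (@adj G) c.

(* The number a(G). *)
Definition forest_number (G : sgraph) : nat :=
  \max_(F : {set G} | `[< acyclic (induced F) >]) #|F|.

(* A drawing without crossings: p places the vertices in the plane, and gamma e
   parametrizes by the unit interval the arc representing the edge e; neither
   vertices nor other edges meet the interior of an arc. *)
Definition planar (R : realType) (G : sgraph) : Prop :=
  exists (p : G -> R * R) (gamma : {set G} -> R -> R * R),
  [/\ injective p,
      forall e, e \in edges G ->
        [/\ {within `[0, 1], continuous (gamma e)},
            {in `[0, 1] &, injective (gamma e)} &
            [set gamma e 0; gamma e 1] = p @` [set` e]],
      forall e (t : R) v, e \in edges G -> t \in `]0, 1[ -> gamma e t <> p v &
      forall e e' (s t : R), e \in edges G -> e' \in edges G -> e != e' ->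
        s \in `]0, 1[ -> t \in `]0, 1[ -> gamma e s <> gamma e' t].

(* Main.v *)
(* A gadget with eleven vertices is placed in a face x, y, z of a planar graph.
   An induced forest F contains at most six of the eleven, and at most five as
   soon as x, or both y and z, belong to F. Three copies are placed in faces of
   a triangulation on six vertices, chosen so that a forest induced on these
   six vertices has at most one vertex more than there are gadgets whose bound
   drops to five. The resulting planar graph has 6 + 3 * 11 = 39 vertices, and
   its induced forests have at most 1 + 3 * 6 = 19 < 39 / 2 vertices. *)

From Stdlib Require Import BinInt.
Require Import Defs.
From mathcomp Require Import all_boot all_order all_algebra.
From mathcomp Require Import all_classical all_reals all_analysis.
From mathcomp Require Import ring lra zify ssrZ.

Import Order.TTheory GRing.Theory Num.Theory.
Import numFieldNormedType.Exports.
Local Open Scope classical_set_scope.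
Local Open Scope ring_scope.

Set Implicit Arguments.
Unset Strict Implicit.
Unset Printing Implicit Defensive.

(** * Straight-line drawings *)

(** Twice the signed area of the triangle [a], [b], [c]. The ring is arbitrary so that signs can be
    computed over [Z] and then transferred to [R]. *)
Definition orient (R : comPzRingType) (a b c : R * R) : R :=
  (b.1 - a.1) * (c.2 - a.2) - (b.2 - a.2) * (c.1 - a.1).

Section StraightLine.
Variable R : realType.
Implicit Types a b c d : R * R.

Definition segment a b (t : R) : R * R :=
  ((1 - t) * a.1 + t * b.1, (1 - t) * a.2 + t * b.2).

Lemma segment0 a b : segment a b 0 = a.
Proof.
by case: a => a1 a2; rewrite /segment subr0 !mul1r !mul0r !addr0.
Qed.

Lemma segment1 a b : segment a b 1 = b.
Proof.
by case: b => b1 b2; rewrite /segment subrr !mul1r !mul0r !add0r.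
Qed.

Lemma orient_segment a b c d t :
  orient a b (segment c d t) = (1 - t) * orient a b c + t * orient a b d.
Proof. by rewrite /orient /=; ring. Qed.

Lemma orient_endl a b : orient a b a = 0.
Proof. by rewrite /orient; ring. Qed.

Lemma orient_endr a b : orient a b b = 0.
Proof. by rewrite /orient; ring. Qed.

Lemma segment_inj a b : a != b -> injective (segment a b).
Proof.
move=> neq_ab s t [e1 e2]; apply/eqP/negPn/negP => neq_st.
have neq0 : t - s != 0 by rewrite subr_eq0 eq_sym.
have h (x y : R) : (1 - s) * x + s * y = (1 - t) * x + t * y -> x = y.
  move=> e; apply: (mulfI neq0); apply/eqP; rewrite -subr_eq0; apply/eqP.
  transitivity ((1 - s) * x + s * y - ((1 - t) * x + t * y)); first by ring.
  by rewrite e subrr.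
move/eqP: neq_ab; apply.
by rewrite [a]surjective_pairing [b]surjective_pairing (h _ _ e1) (h _ _ e2).
Qed.

Lemma segment_continuous a b : continuous (segment a b).
Proof.
move=> t; have h (x y : R) : (1 - u) * x + u * y @[u --> t] --> (1 - t) * x + t * y.
  by apply: cvgD; apply: cvgM; do ?[exact: cvg_cst | exact: cvg_id | apply: cvgB].
exact: cvg_pair (h _ _) (h _ _).
Qed.

Definition same_side a b c d := 0 < orient a b c * orient a b d.

(** The function [orient a b] vanishes on the line through [a] and [b], whereas inside the segment
    from [c] to [d] it is a convex combination of two nonzero numbers of equal sign. *)
Lemma same_side_disjoint a b c d s t :
  0 < t < 1 -> same_side a b c d -> segment a b s <> segment c d t.
Proof.
move=> /andP[t0 t1] side e.
have : orient a b (segment a b s) = 0.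
  by rewrite orient_segment orient_endl orient_endr !mulr0 addr0.
rewrite e orient_segment => h; move: side; rewrite /same_side.
have s0 : 0 < 1 - t by lra.
set u := orient a b c in h *; set v := orient a b d in h *.
have : t * (u * v) = - (1 - t) * u ^+ 2.
  transitivity (u * ((1 - t) * u + t * v) - (1 - t) * u ^+ 2); first by ring.
  by rewrite h; ring.
move=> h2 uv; have := mulr_gt0 t0 uv; rewrite h2 mulNr oppr_gt0 ltNge.
by rewrite mulr_ge0 ?sqr_ge0// ltW.
Qed.

(* [o] lists each edge in one direction, so that the finitely many tests need
   not be repeated for both. Edges sharing an end are covered by general position. *)
Lemma straight_line_planar (G : sgraph) (o : rel G) (p : G -> R * R) :
    (forall x y, adj x y = o x y || o y x) ->
    injective p ->
    (forall x y v, o x y -> v != x -> v != y ->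
       orient (p x) (p y) (p v) != 0) ->
    (forall x y z w, o x y -> o z w -> [&& x != z, x != w, y != z & y != w] ->
       same_side (p x) (p y) (p z) (p w) \/ same_side (p z) (p w) (p x) (p y)) ->
  planar R G.
Proof.
move=> adjE p_inj genpos sides.
have o_neq x y : o x y -> x != y.
  move=> oxy; apply/eqP => e; move: oxy; rewrite -e => oxx.
  by have := adj_irrefl x; rewrite adjE oxx.
(* An edge is an unordered pair, so an orientation in [o] is picked for it. The constant default in
   [gamma] is never met on an edge. *)
pose ends (e : {set G}) := [pick q : G * G | o q.1 q.2 && (e == [set q.1; q.2]%SET)].
pose gamma e := if ends e is Some q then segment (p q.1) (p q.2) else fun=> 0.
have endsP e : e \in edges G ->
    exists x y, [/\ o x y, e = [set x; y]%SET & gamma e = segment (p x) (p y)].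
  move=> eG; rewrite /gamma /ends; case: pickP => [[x y] /= /andP[oxy /eqP ->]|none].
    by exists x, y.
  have [x y _ axy def_e] := imset2P eG; have : adj x y := axy.
  rewrite adjE => /orP[] oxy.
    by have /negP[] := negbT (none (x, y)); rewrite /= oxy def_e eqxx.
  by have /negP[] := negbT (none (y, x)); rewrite /= oxy def_e finset.setUC eqxx.
have on_line x y t : orient (p x) (p y) (segment (p x) (p y) t) = 0.
  by rewrite orient_segment orient_endl orient_endr !mulr0 addr0.
exists p, gamma; split=> //.
- move=> e /endsP[x [y [oxy -> ->]]].
  have pxy : p x != p y by rewrite (eqtype.inj_eq p_inj) o_neq.
  split; first by apply/continuous_subspaceT/segment_continuous.
    by move=> s t _ _; apply: segment_inj.
  rewrite segment0 segment1; apply/seteqP; split=> [z /= [->|->]|z /= [v]].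
  + by exists x; rewrite //= !inE eqxx.
  + by exists y; rewrite //= !inE eqxx orbT.
  + by rewrite !inE => /orP[]/eqP -> <-; [left|right].
- move=> e t v /endsP[x [y [oxy _ ->]]]; rewrite in_itv /= => /andP[t0 t1].
  have pxy : p x != p y by rewrite (eqtype.inj_eq p_inj) o_neq.
  have [-> /esym|nvx] := eqVneq v x.
    rewrite -[X in X = _](segment0 _ (p y)) => /(segment_inj pxy) t0'.
    by rewrite -t0' ltxx in t0.
  have [-> /esym|nvy] := eqVneq v y.
    rewrite -[X in X = _](segment1 (p x)) => /(segment_inj pxy) t1'.
    by rewrite -t1' ltxx in t1.
  by move=> e'; have /eqP[] := genpos _ _ _ oxy nvx nvy; rewrite -e' on_line.
move=> e e' s t /endsP[x [y [oxy -> ->]]] /endsP[z [w [ozw -> ->]]] neq.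
rewrite !in_itv /= => s01 t01; have /andP[t0 t1] := t01.
have ones c d : segment c d t = segment d c (1 - t).
  by rewrite /segment; congr (_, _); ring.
(* When the edges share only the end [u], the value of [orient] along the second one is [r] times
   its value at [v], which general position makes nonzero. Reversing the segment by [ones] handles a
   common end in second place. *)
have shared u v : o x y -> u \in [set x; y]%SET -> v \notin [set x; y]%SET ->
    forall r, 0 < r < 1 -> segment (p x) (p y) s <> segment (p u) (p v) r.
  move=> _ uin; rewrite !inE negb_or => /andP[vx vy] r /andP[r0 _] eqs.
  have := on_line x y s; rewrite eqs orient_segment.
  have -> : orient (p x) (p y) (p u) = 0.
    by move: uin; rewrite !inE => /orP[]/eqP ->; rewrite ?orient_endl ?orient_endr.
  rewrite mulr0 add0r => /eqP; rewrite mulf_eq0 (gt_eqF r0) /=.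
  by apply/negP/genpos.
have [zin|zout] := boolP (z \in [set x; y]%SET).
  (* If [w] were an end of the first edge too, the two edges would coincide by cardinality. *)
  apply: shared => //; apply: contra neq => win; rewrite eq_sym eqEcard.
  rewrite finset.subUset !finset.sub1set zin win !cards2.
  by rewrite (o_neq _ _ oxy) (o_neq _ _ ozw).
have [win|wout] := boolP (w \in [set x; y]%SET).
  by rewrite ones; apply: shared => //; lra.
move: zout wout; rewrite !inE !negb_or => /andP[zx zy] /andP[wx wy].
have [|side|side] := sides _ _ _ _ oxy ozw.
- by rewrite ![x == _]eq_sym ![y == _]eq_sym zx wx zy wy.
- exact: same_side_disjoint.
- by move/esym; apply: same_side_disjoint.
Qed.

End StraightLine.

(** * Graphs given by lists of edges *)

(** A cycle of [G] inside [F] lifts entry by entry to the subtype of vertices of the induced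
    subgraph, whose adjacency is inherited from [G]. *)
Lemma acyclic_avoids (G : sgraph) (F : {set G}) (c : seq G) :
  acyclic (Defs.induced F) -> (2 < size c)%N -> ucycle (@adj G) c ->
  ~~ all (mem F) c.
Proof.
move=> acy size_c /andP[cyc_c uniq_c]; apply/negP => cF.
pose c' : seq (Defs.induced F) := pmap insub c.
have c'E : map val c' = c.
  rewrite pmap_filter; last exact: insubK.
  by apply/all_filterP; apply: sub_all cF => x; rewrite /= isSome_insub.
apply: (acy c'); first by rewrite -(size_map val) c'E.
rewrite -c'E in cyc_c uniq_c; apply/andP; split; last exact: map_uniq uniq_c.
by case: (c') cyc_c => //= x s; rewrite -map_rcons path_map.
Qed.

(** Plain numbers instead of ordinals keep adjacency and cycle tests decidable by [vm_compute]. *)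
Definition edge_rel (E : seq (nat * nat)) : rel nat :=
  fun i j => ((i, j) \in E) || ((j, i) \in E).

Definition edge_cycle E c := [&& 2 < size c, uniq c & cycle (edge_rel E) c]%N.

Lemma edge_relC E : symmetric (edge_rel E).
Proof. by move=> i j; rewrite /edge_rel orbC. Qed.

Section ListGraph.
Variables (n : nat) (E : seq (nat * nat)).
Hypothesis loopless : all (fun e => e.1 != e.2) E.

Lemma edge_rel_irr : irreflexive (edge_rel E).
Proof.
by move=> i; rewrite /edge_rel orbb; apply/negP => /(allP loopless)/=; rewrite eqxx.
Qed.

Definition list_graph : sgraph :=
  @SGraph 'I_n (fun i j => edge_rel E i j)
    (fun i j => edge_relC E i j) (fun i => edge_rel_irr i).

Lemma degree_list_graph (x : list_graph) :
  degree x = count (edge_rel E (x : 'I_n)) (iota 0 n).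
Proof.
rewrite /degree cardsE -sum1_card -val_enum_ord count_map -sum1_count.
by rewrite [LHS]big_mkcond [RHS]big_mkcond big_enum.
Qed.

(** Numbers outside ['I_n] count as nonmembers, so a list of members consists of actual vertices. *)
Definition nat_mem (F : {set list_graph}) (i : nat) : bool :=
  oapp (fun v : 'I_n => v \in F) false (insub i).

Lemma card_nat_mem (F : {set list_graph}) : #|F| = count (nat_mem F) (iota 0 n).
Proof.
rewrite -sum1_card -val_enum_ord count_map -sum1_count big_mkcond [RHS]big_mkcond.
by rewrite big_enum; apply: eq_bigr => v _; rewrite /= /nat_mem valK.
Qed.

Lemma nat_mem_avoids (F : {set list_graph}) c :
  acyclic (Defs.induced F) -> edge_cycle E c -> ~~ all (nat_mem F) c.
Proof.
move=> acy /and3P[size_c uniq_c cyc_c]; apply/negP => cF.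
pose c' : seq list_graph := pmap insub c.
have c'E : map val c' = c.
  rewrite pmap_filter; last exact: insubK.
  apply/all_filterP; apply: sub_all cF => i; rewrite /nat_mem.
  by case: insub.
have /negP[] : ~~ all (mem F) c'.
  apply: acyclic_avoids => //; first by rewrite -(size_map val) c'E.
  rewrite -c'E in cyc_c uniq_c; apply/andP; split; last exact: map_uniq uniq_c.
  by case: (c') cyc_c => //= x s; rewrite -map_rcons path_map.
by move: cF; rewrite -c'E all_map; apply: sub_all => v; rewrite /= /nat_mem valK.
Qed.

End ListGraph.

(** * Exhaustive search over bit vectors *)

Fixpoint all_bits (n : nat) (P : seq bool -> bool) : bool :=
  if n is n'.+1 then
    all_bits n' (fun s => P (true :: s)) && all_bits n' (fun s => P (false :: s))
  else P [::].

Lemma all_bitsP n P : all_bits n P -> forall s, size s = n -> P s.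
Proof.
elim: n P => [|n IHn] P /=; first by move=> P0 [].
by move=> /andP[PT PF] [|[] s] //= [size_s]; [apply: (IHn _ PT)|apply: (IHn _ PF)].
Qed.

(* In the uses, [cycles] lists cycles of a graph and [b] is the indicator of an
   induced forest. *)
Lemma all_bits_avoid n (cycles : seq (seq nat)) (Q : seq bool -> bool)
    (b : nat -> bool) :
    all (all (fun i => i < n)%N) cycles ->
    all_bits n (fun s => Q s || has (all (nth false s)) cycles) ->
    all (fun c => ~~ all b c) cycles ->
  Q (mkseq b n).
Proof.
move=> bound /all_bitsP/(_ (mkseq b n)); rewrite size_mkseq => /(_ erefl) /orP[//|].
move=> /hasP[c c_in allc] /allP/(_ c c_in) /negP[]; apply/allP => i ic.
by have := allP allc i ic; rewrite nth_mkseq // (allP (allP bound c c_in)).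
Qed.

(** * The gadget *)

(* A triangulation of the sphere found by exhaustive search: the corners 0, 1, 2
   span a face, and the eleven other vertices have degree at least five. *)
Definition gadget_edges : seq (nat * nat) :=
  [:: (0, 1); (0, 2); (0, 4); (0, 5); (0, 9); (0, 10); (1, 2); (1, 3);
    (1, 4); (2, 3); (2, 5); (3, 4); (3, 5); (3, 6); (3, 7); (4, 7); (4, 8);
    (4, 9); (5, 6); (5, 10); (5, 11); (6, 7); (6, 11); (6, 12); (7, 8);
    (7, 12); (8, 9); (8, 12); (8, 13); (9, 10); (9, 13); (10, 11);
    (10, 13); (11, 12); (11, 13); (12, 13)]%N.

(* Enough chordless cycles to meet every set that violates [gadget_bound]. *)
Definition gadget_cycles : seq (seq nat) :=
  [:: [:: 0; 4; 9]; [:: 0; 5; 10]; [:: 0; 9; 10]; [:: 1; 2; 3]; [:: 3; 4; 7];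
    [:: 3; 5; 6]; [:: 3; 6; 7]; [:: 4; 7; 8]; [:: 4; 8; 9]; [:: 5; 6; 11];
    [:: 5; 10; 11]; [:: 6; 7; 12]; [:: 6; 11; 12]; [:: 7; 8; 12];
    [:: 8; 9; 13]; [:: 8; 12; 13]; [:: 9; 10; 13]; [:: 10; 11; 13];
    [:: 11; 12; 13]; [:: 0; 4; 3; 5]; [:: 0; 4; 8; 13; 10];
    [:: 0; 5; 11; 13; 9]; [:: 3; 4; 8; 12; 6]; [:: 3; 5; 11; 12; 7];
    [:: 4; 7; 12; 13; 9]; [:: 5; 6; 12; 13; 10]; [:: 0; 4; 3; 6; 11; 10];
    [:: 0; 4; 8; 12; 11; 10]; [:: 0; 5; 3; 7; 8; 9];
    [:: 0; 5; 11; 12; 8; 9]; [:: 1; 2; 5; 6; 7; 4]; [:: 1; 2; 5; 10; 9; 4];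
    [:: 3; 4; 8; 13; 11; 6]; [:: 3; 5; 11; 13; 8; 7];
    [:: 4; 7; 6; 11; 10; 9]; [:: 4; 7; 6; 11; 13; 9];
    [:: 4; 7; 12; 11; 10; 9]; [:: 5; 6; 7; 8; 9; 10];
    [:: 5; 6; 7; 8; 13; 10]; [:: 5; 6; 12; 8; 9; 10];
    [:: 6; 7; 8; 9; 10; 11]; [:: 0; 4; 3; 6; 12; 13; 10];
    [:: 0; 5; 3; 7; 12; 13; 9]; [:: 1; 2; 5; 6; 12; 8; 4];
    [:: 1; 2; 5; 10; 13; 8; 4]; [:: 1; 2; 5; 11; 12; 7; 4];
    [:: 1; 2; 5; 11; 13; 9; 4]; [:: 1; 2; 5; 6; 12; 13; 9; 4];
    [:: 1; 2; 5; 10; 13; 12; 7; 4]]%N.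

(** Each of the 2^14 vertex subsets either satisfies the inequality or contains a listed cycle. Read
    as 0 or 1, the boolean merges the bounds six and five into one inequality. *)
Lemma gadget_bound (b : nat -> bool) :
    all (fun c => ~~ all b c) gadget_cycles ->
  (count b (iota 3 11) + (b 0 || b 1 && b 2) <= 6)%N.
Proof.
pose Q s := (count id (drop 3 s)
  + (nth false s 0 || nth false s 1 && nth false s 2) <= 6)%N.
have bits : all_bits 14 (fun s => Q s || has (all (nth false s)) gadget_cycles).
  by vm_compute.
move=> avoid.
by have := all_bits_avoid (n := 14) (cycles := gadget_cycles) isT bits avoid.
Qed.

(** * The counterexample *)

Definition base_edges : seq (nat * nat) :=
  [:: (0, 1); (0, 2); (0, 3); (0, 4); (1, 2); (1, 3); (1, 4); (1, 5); (2, 4);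
    (3, 4); (3, 5); (4, 5)]%N.

Definition base_cycles : seq (seq nat) :=
  [:: [:: 0; 1; 2]; [:: 0; 1; 3]; [:: 0; 1; 4]; [:: 0; 2; 4]; [:: 0; 3; 4];
    [:: 1; 2; 4]; [:: 1; 3; 4]; [:: 1; 3; 5]; [:: 1; 4; 5]; [:: 3; 4; 5]]%N.

(** The order matters: the first corner alone lowers the gadget bound, the other two only
    jointly. *)
Definition corners (k : nat) : seq nat :=
  nth [::] [:: [:: 5; 1; 3]; [:: 4; 0; 3]; [:: 2; 0; 1]]%N k.

(* The eleven inner vertices of the gadget get an interval of fresh numbers. *)
Definition attach (k i : nat) : nat :=
  if (i < 3)%N then nth 0%N (corners k) i else (11 * k + i + 3)%N.

(** Edges between corners recur in the copies, possibly reversed; this is harmless because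
    [edge_rel] tests membership in either direction. *)
Definition glued_edges : seq (nat * nat) :=
  base_edges ++
    [seq (attach k e.1, attach k e.2) | k <- iota 0 3, e <- gadget_edges].

Lemma glued_loopless : all (fun e => e.1 != e.2) glued_edges.
Proof. by vm_compute. Qed.

Definition glued : sgraph := @list_graph 39 glued_edges glued_loopless.

Lemma base_bound (b : nat -> bool) :
    all (fun c => ~~ all b c) base_cycles ->
  (count b (iota 0 6) <= 1 + ((b 5 || b 1 && b 3) + (b 4 || b 0 && b 3)
                              + (b 2 || b 0 && b 1)))%N.
Proof.
pose Q s := let b := nth false s in
  (count id s <= 1 + ((b 5 || b 1 && b 3) + (b 4 || b 0 && b 3)
                      + (b 2 || b 0 && b 1)))%N.
have bits : all_bits 6 (fun s => Q s || has (all (nth false s)) base_cycles).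
  by vm_compute.
move=> avoid.
by have := all_bits_avoid (n := 6) (cycles := base_cycles) isT bits avoid.
Qed.

(** The boolean terms cancel on summation: each one allows an extra vertex in the base and removes
    one from a gadget. *)
Lemma glued_forest_number : (forest_number glued <= 19)%N.
Proof.
apply/bigmax_leqP => F /asboolP acy; rewrite card_nat_mem.
set b := nat_mem F.
have avoid cs : all (edge_cycle glued_edges) cs -> all (fun c => ~~ all b c) cs.
  by apply: sub_all => c; apply: nat_mem_avoids.
have gadgets k : (k < 3)%N ->
    (count b (iota (11 * k + 6) 11)
      + (b (attach k 0) || b (attach k 1) && b (attach k 2)) <= 6)%N.
  move=> k3.
  have -> : iota (11 * k + 6) 11 = map (attach k) (iota 3 11).
    by move: k k3; do 3?case=> //.
  rewrite count_map; apply: (@gadget_bound (b \o attach k)).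
  (* Gluing preserves the listed cycles, as is checked for each copy by computation. *)
  have : all (edge_cycle glued_edges) (map (map (attach k)) gadget_cycles).
    by move: k k3; do 3?[case; first by vm_compute].
  by move=> /avoid; rewrite all_map; apply: sub_all => c /=; rewrite all_map.
have := base_bound (avoid base_cycles isT).
have : (count b (iota 6 11) + (b 5 || b 1 && b 3) <= 6)%N := gadgets 0 isT.
have : (count b (iota 17 11) + (b 4 || b 0 && b 3) <= 6)%N := gadgets 1 isT.
have : (count b (iota 28 11) + (b 2 || b 0 && b 1) <= 6)%N := gadgets 2 isT.
rewrite -[iota 0 39]/(iota 0 6 ++ iota 6 11 ++ iota 17 11 ++ iota 28 11) !count_cat.
move: (count b _) (count b _) (count b _) (count b _) => n3 n2 n1 n0.
move: (nat_of_bool _) (nat_of_bool _) (nat_of_bool _) => t2 t1 t0.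
by clear; lia.
Qed.

Lemma glued_min_degree : min_degree glued = 5%N.
Proof.
rewrite /min_degree card_ord.
under eq_bigr do rewrite degree_list_graph.
rewrite -(big_mkord xpredT (fun i => count (edge_rel glued_edges i) (iota 0 39))).
(* Unlocking the iterated operator lets the minimum be evaluated. *)
by rewrite unlock; vm_compute.
Qed.

(** * An integral straight-line drawing of the counterexample *)

Local Open Scope Z_scope.

(* A rounded barycentric embedding with outer face 1, 2, 4. *)
Definition coordinates : seq (Z * Z) :=
  [:: (496, 355); (0, 0); (500, 1000); (497, 54); (1000, 0); (518, 2);
    (241, 24); (235, 2); (390, 31); (319, 24); (280, 13); (306, 5);
    (376, 3); (436, 8); (370, 19); (328, 13); (368, 8); (600, 182);
    (740, 171); (745, 52); (690, 126); (690, 150); (785, 117); (874, 76);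
    (878, 35); (787, 76); (750, 111); (821, 80); (225, 288); (423, 630);
    (249, 484); (277, 441); (314, 472); (382, 647); (444, 813); (385, 753);
    (323, 598); (334, 562); (379, 687)].

Local Close Scope Z_scope.

Definition point (i : nat) : Z * Z := nth (0, 0) coordinates i.

Definition general_position : bool :=
  all (fun e => all (fun v => [|| v == e.1, v == e.2 |
      orient (point e.1) (point e.2) (point v) != 0]) (iota 0 39)) glued_edges.

(** The integer counterpart of [same_side], with the computable comparison [Z.ltb]. *)
Definition separated (x y z w : nat) : bool :=
  Z.ltb 0 (orient (point x) (point y) (point z)
                  * orient (point x) (point y) (point w)).

Definition crossing_free : bool :=
  all (fun e => all (fun f =>
      [|| e.1 == f.1, e.1 == f.2, e.2 == f.1, e.2 == f.2,
          separated e.1 e.2 f.1 f.2 | separated f.1 f.2 e.1 e.2])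
    glued_edges) glued_edges.

Lemma general_positionT : general_position.
Proof. by vm_compute. Qed.

Lemma crossing_freeT : crossing_free.
Proof. by vm_compute. Qed.

Section Drawing.
Variable R : realType.

Definition real_of_Z (z : Z) : R := (int_of_Z z)%:~R.

Definition real_point (q : Z * Z) : R * R :=
  (real_of_Z q.1, real_of_Z q.2).

Lemma real_of_Z_inj : injective real_of_Z.
Proof. by move=> x y /intr_inj /(can_inj int_of_ZK). Qed.

Lemma real_of_Z_gt0 z : Z.ltb 0 z -> 0 < real_of_Z z.
Proof. by rewrite /real_of_Z ltr0z; case: z => //= p _; lia. Qed.

(** Being a polynomial with integer coefficients, [orient] commutes with the ring morphism from [Z]
    to [R]; this carries the sign tests over to the real plane. *)
Lemma orient_real a b c :
  orient (real_point a) (real_point b) (real_point c) = real_of_Z (orient a b c).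
Proof. by rewrite /orient /real_of_Z !(rmorphB, rmorphM). Qed.

Lemma glued_planar : planar R glued.
Proof.
pose o : rel glued := fun x y => (val x, val y) \in glued_edges.
apply: (@straight_line_planar _ glued o (fun x => real_point (point x))).
- by [].
- move=> x y [/real_of_Z_inj e1 /real_of_Z_inj e2]; apply/val_inj/eqP.
  have uniq_coordinates : uniq coordinates by vm_compute.
  rewrite -(nth_uniq (0, 0) _ _ uniq_coordinates) ?ltn_ord//.
  by apply/eqP; rewrite [LHS]surjective_pairing e1 e2 -surjective_pairing.
- move=> x y v oxy vx vy; rewrite orient_real.
  have /allP/(_ (val v)) := allP general_positionT _ oxy.
  rewrite mem_iota ltn_ord => /(_ isT) /=.
  rewrite [val v == _](negbTE vx) [val v == _](negbTE vy) /=.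
  by apply: contra_neq => /(@real_of_Z_inj _ 0).
move=> x y z w oxy ozw /and4P[xz xw yz yw].
have := allP (allP crossing_freeT _ oxy) _ ozw.
rewrite /= [val x == _](negbTE xz) [val x == _](negbTE xw).
rewrite [val y == _](negbTE yz) [val y == _](negbTE yw) /=.
rewrite /same_side !orient_real -!rmorphM.
by case/orP => /real_of_Z_gt0; [left|right].
Qed.

End Drawing.

Theorem corollary6p7 (R : realType) :
  ~ (forall G : sgraph, planar R G ->
       #|G|%:R / 2 <= (forest_number G)%:R :> R)
  /\ exists G : sgraph,
       [/\ planar R G, min_degree G = 5%N &
           (forest_number G)%:R < #|G|%:R / 2 :> R].
Proof.
have small : (forest_number glued)%:R < #|glued|%:R / 2 :> R.
  have : (forest_number glued)%:R <= 19 :> R by rewrite ler_nat glued_forest_number.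
  by rewrite card_ord; lra.
split=> [half|].
  by have := half _ (glued_planar R); rewrite leNgt small.
by exists glued; split; [exact: glued_planar|exact: glued_min_degree|].
Qed.
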